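(* Let $\bm H$ be a finite-dimensional Hilbert space and $\rho_{\rm i}$ a density operator on $\bm H$. Let $1\le m<N$. Let $\mathcal E_1,\dots,\mathcal E_m:L(\bm H)\to L(\bm H)$ be completely positive trace-preserving (CPTP) maps, each $\mathcal E_n$ having a unique steady state $\rho_{{\rm ss},n}$ (density operator with $\mathcal E_n(\rho_{{\rm ss},n})=\rho_{{\rm ss},n}$), assumed positive definite. Set $\rho_0:=\rho_{\rm i}$, $\rho_n:=\mathcal E_n(\rho_{n-1})$ for $1\le n\le m$. Let $\{M_b\}_{b\in B}\subset L(\bm H)$, $B$ finite, with $\sum_b M_b^\dagger M_b=I$; put $p(b):=\mathrm{tr}[M_b^\dagger M_b\rho_m]$ and, for $p(b)>0$, $\rho_m^{(b)}:=M_b\rho_mM_b^\dagger/p(b)$, and $I_{\rm QC}:=S(\rho_m)-\sum_b p(b)S(\rho_m^{(b)})$. For each $b$ with $p(b)>0$ let $\mathcal E^{(b)}_{m+1},\dots,\mathcal E^{(b)}_N$ be CPTP maps on $L(\bm H)$, each $\mathcal E^{(b)}_n$ having a unique, positive definite steady state $\rho^{(b)}_{{\rm ss},n}$, and set $\rho_n^{(b)}:=\mathcal E_n^{(b)}(\rho_{n-1}^{(b)})$ for $m+1\le n\le N$. Define $$\sigma^B_{\rm ex}:=\sum_{n=1}^m\big(\mathrm{tr}[\rho_n\ln\rho_{{\rm ss},n}]-\mathrm{tr}[\rho_{n-1}\ln\rho_{{\rm ss},n}]\big)+\sum_b p(b)\sum_{n=m+1}^N\big(\mathrm{tr}[\rho^{(b)}_n\ln\rho^{(b)}_{{\rm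 ss},n}]-\mathrm{tr}[\rho^{(b)}_{n-1}\ln\rho^{(b)}_{{\rm ss},n}]\big).$$ Then (sums over $b$ with $p(b)>0$) $$\sum_b p(b)\,S(\rho_N^{(b)})-S(\rho_{\rm i})\ \ge\ -\sigma^B_{\rm ex}-I_{\rm QC}.$$
   Context: $L(\bm H)$ is the space of linear operators on $\bm H$. $S(\rho):=-\mathrm{tr}[\rho\ln\rho]$ is the von Neumann entropy (with $0\ln0=0$). *)

(* Defs.v *)
From HB Require Import structures.
From mathcomp Require Import all_boot all_order all_algebra.
From mathcomp Require Import sesquilinear spectral.
From mathcomp Require Import complex mxtens.
From mathcomp Require Import reals exp.

Set Implicit Arguments.
Unset Strict Implicit.
Unset Printing Implicit Defensive.
Import Order.TTheory GRing.Theory Num.Theory Num.Def.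
Local Open Scope ring_scope.

Section QDefs.
Variable R : realType.
Local Notation C := R[i].

Definition adj {m n} (A : 'M[C]_(m, n)) : 'M[C]_(n, m) := (map_mx conjC A)^T.

Definition hermitian {n} (A : 'M[C]_n) : Prop := adj A = A.

Definition psd {n} (A : 'M[C]_n) : Prop :=
  hermitian A /\ forall v : 'rV[C]_n, 0 <= (v *m A *m adj v) 0 0.

Definition posdef {n} (A : 'M[C]_n) : Prop :=
  hermitian A /\ forall v : 'rV[C]_n, v != 0 -> 0 < (v *m A *m adj v) 0 0.

Definition density {n} (rho : 'M[C]_n) : Prop := psd rho /\ \tr rho = 1.

(* Functional calculus for Hermitian matrices through the spectral
   decomposition  A = U^-1 diag(d) U  (eigenvalues d are real). *)
Definition mxfun {n} (f : R -> R) (A : 'M[C]_n) : 'M[C]_n :=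
  invmx (spectralmx A)
    *m diag_mx (map_mx (fun z : C => (f (complex.Re z))%:C%C) (spectral_diag A))
    *m spectralmx A.

(* matrix logarithm; note mathcomp-analysis has ln 0 = 0 *)
Definition logm {n} (A : 'M[C]_n) : 'M[C]_n := mxfun (@ln R) A.

(* tr[rho ln sigma] (a real number for Hermitian rho, sigma) *)
Definition trlog {n} (rho sigma : 'M[C]_n) : R :=
  complex.Re (\tr (rho *m logm sigma)).

(* von Neumann entropy S(rho) = - tr[rho ln rho], with 0 ln 0 = 0
   (since ln 0 = 0 the zero eigenvalues contribute 0 * 0 = 0) *)
Definition vN_entropy {n} (rho : 'M[C]_n) : R := - trlog rho rho.

Definition mxblock_at {k n} (X : 'M[C]_(k * n)) (a b : 'I_k) : 'M[C]_n :=
  \matrix_(i, j) X (mxtens_index (a, i)) (mxtens_index (b, j)).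

Definition ampliation {n} (E : 'M[C]_n -> 'M[C]_n) (k : nat) (X : 'M[C]_(k * n))
  : 'M[C]_(k * n) :=
  \sum_(a < k) \sum_(b < k) tensmx (delta_mx a b : 'M[C]_k) (E (mxblock_at X a b)).

Definition completely_positive {n} (E : {linear 'M[C]_n -> 'M[C]_n}) : Prop :=
  forall (k : nat) (X : 'M[C]_(k * n)), psd X -> psd (ampliation E X).

Definition trace_preserving {n} (E : {linear 'M[C]_n -> 'M[C]_n}) : Prop :=
  forall X : 'M[C]_n, \tr (E X) = \tr X.

Definition CPTP {n} (E : {linear 'M[C]_n -> 'M[C]_n}) : Prop :=
  completely_positive E /\ trace_preserving E.

Definition unique_steady_state {n} (E : {linear 'M[C]_n -> 'M[C]_n})
  (sigma : 'M[C]_n) : Prop :=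
  density sigma /\ E sigma = sigma /\
  forall tau : 'M[C]_n, density tau -> E tau = tau -> tau = sigma.

(* evolve E s rho j = state at time s + j, starting from rho at time s,
   applying the channel E t at step t *)
Fixpoint evolve {n} (E : nat -> {linear 'M[C]_n -> 'M[C]_n}) (s : nat)
  (rho : 'M[C]_n) (j : nat) : 'M[C]_n :=
  match j with
  | 0 => rho
  | j'.+1 => E (s + j'.+1)%N (evolve E s rho j')
  end.

End QDefs.

(* Main.v *)
(* Each step of the protocol is the data processing inequality
   D(E rho || E sigma) <= D(rho || sigma) for relative entropy, at a full-rank
   fixed point sigma of E; summing over the steps telescopes.

   For the data processing inequality, let l_i, m_j be the eigenvalues of rho,
   sigma and w_ij the squared overlaps of their eigenvectors. For t > 0 the number
     q_t(rho, sigma) = sum_ij w_ij l_i^2 / (m_j + t l_i)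
   is the maximum over X of
     2 Re tr(X rho) - tr(X^H sigma X) - t tr(X rho X^H),
   and taking X to be the image of the optimal Y for (E rho, E sigma) under the
   dual of E, the Schwarz inequality for that dual map gives
   q_t(E rho, E sigma) <= q_t(rho, sigma). Now q_t is the derivative of
   sum_ij l_i w_ij ln(m_j + t l_i), whose value at t = 0 is tr[rho ln sigma] and
   which is tr[rho] ln t + tr[rho ln rho] + o(1) as t goes to infinity. Integrating
   the comparison of the derivatives yields the inequality without operator
   convexity. *)
Require Import Defs.
From HB Require Import structures.
From mathcomp Require Import all_boot all_order all_algebra.
From mathcomp Require Import sesquilinear spectral.
From mathcomp Require Import complex mxtens.
From mathcomp Require Import reals exp.
From mathcomp Require Import boolp functions topology normedtype derive realfun.
From mathcomp Require Import ring lra.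
Import Order.TTheory GRing.Theory Num.Theory Num.Def.
Import numFieldNormedType.Exports.
Local Open Scope ring_scope.

(** * Weighted sums of logarithms along a ray, from [0] to infinity *)

Section LogCombination.
Variables (R : realType) (K : finType) (c x y : K -> R).
Hypotheses (x_gt0 : forall k, 0 < x k) (y_ge0 : forall k, 0 <= y k).

Let F (t : R) := \sum_k c k * ln (x k + t * y k).
Let F' (t : R) := \sum_k c k * (y k / (x k + t * y k)).

Let arg_gt0 k (t : R) : 0 <= t -> 0 < x k + t * y k.
Proof. by move=> t0; rewrite ltr_pwDl// mulr_ge0. Qed.

Lemma is_derive_log_combination (t : R) : 0 <= t -> is_derive t 1 F (F' t).
Proof.
move=> t0.
have -> : F = \sum_k (fun s => c k * ln (x k + s * y k)).
  by apply/funext => s; rewrite fct_sumE.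
rewrite /F'.
apply: (big_ind2 (fun f f' => is_derive t 1 f f')) => [|f f' g g' ff' gg'|k _].
- exact: is_derive_cst.
- exact: is_deriveD.
have arg : is_derive t 1 (fun s => x k + s * y k) (y k).
  by apply: is_derive_eq; rewrite /= add0r /GRing.scale/=; ring.
have l : is_derive (x k + t * y k) 1 (@ln R) (x k + t * y k)^-1.
  by apply: is_derive1_ln; exact: arg_gt0.
have co := @is_derive1_comp R (@ln R) (fun s => x k + s * y k) t _ _ l arg.
rewrite /comp/= in co.
by apply: is_derive_eq; rewrite /GRing.scale/=; ring.
Qed.

Lemma log_combination_nondecreasing (t : R) :
  (forall s, 0 < s -> 0 <= F' s) -> 0 < t -> F 0 <= F t.
Proof.
move=> F'_ge0 t0.
have [s|z|s] := @MVT _ F F' 0 t t0.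
- by rewrite in_itv/= => /andP[/ltW s0 _]; exact: is_derive_log_combination.
- move: z; apply: derivable_within_continuous => s.
  rewrite in_itv/= => /andP[s0 _].
  by case: (is_derive_log_combination s s0).
- rewrite in_itv/= subr0 -subr_ge0 => /andP[s0 _] ->.
  by rewrite mulr_ge0// ?F'_ge0// ltW.
Qed.

(** The difference is [ln (1 + s * (a / b))], and [0 <= ln (1 + z) <= z] for [z > 0]. With [s] the
    inverse of [t], this controls the limit at infinity. *)
Lemma ln_perturb_le (a b s : R) : 0 < a -> 0 < b -> 0 < s ->
  `|ln (s * a + b) - ln b| <= s * (a / b).
Proof.
move=> a0 b0 s0.
have sa : 0 < s * a by rewrite mulr_gt0.
have -> : ln (s * a + b) - ln b = ln (1 + s * (a / b)).
  rewrite -ln_div ?posrE ?addr_gt0//; congr ln; field; exact: lt0r_neq0.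
have sab : 0 < s * (a / b) by rewrite mulr_gt0// divr_gt0.
rewrite ger0_norm; first by apply: le_ln1Dx; rewrite (lt_trans _ sab)// ltrN10.
by rewrite ln_ge0// lerDl ltW.
Qed.

(* The increasing function [F] runs from the left-hand side at [0] to the
   right-hand side at infinity, where the [ln t] terms cancel. *)
Lemma log_combination_le :
  \sum_k c k = 0 -> (forall k, y k = 0 -> c k = 0) ->
  (forall s, 0 < s -> 0 <= F' s) ->
  \sum_k c k * ln (x k) <= \sum_k c k * ln (y k).
Proof.
move=> c_sum c_supp F'_ge0.
(* [s * D] bounds the distance of [F s^-1] from its limit. Where [y k = 0] the quotient is [0] by
   convention, in agreement with [c k = 0]. *)
pose D := \sum_k `|c k| * (x k / y k).
have D_ge0 : 0 <= D.
  by apply: sumr_ge0 => k _; rewrite mulr_ge0// divr_ge0// ltW.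
have step s : 0 < s ->
    \sum_k c k * ln (x k) <= \sum_k c k * ln (y k) + s * D.
  move=> s0; have t0 : 0 < s^-1 by rewrite invr_gt0.
  have := log_combination_nondecreasing _ F'_ge0 t0.
  have -> : F 0 = \sum_k c k * ln (x k).
    by apply: eq_bigr => k _; rewrite mul0r addr0.
  move=> /le_trans; apply.
  (* Since the [c k] sum to zero, [ln s] may be added to every logarithm; this turns
     [x k + s^-1 * y k] into [s * x k + y k], which tends to [y k]. *)
  have -> : F s^-1 = \sum_k c k * (ln (x k + s^-1 * y k) + ln s).
    under [RHS]eq_bigr do rewrite mulrDr.
    by rewrite big_split/= -mulr_suml c_sum mul0r addr0.
  rewrite mulr_sumr -big_split/=; apply: ler_sum => k _.
  have [yk0|yk0] := eqVneq (y k) 0.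
    by rewrite c_supp// normr0 !mul0r mulr0 addr0.
  have yk : 0 < y k by rewrite lt0r yk0 y_ge0.
  rewrite -lnM ?posrE ?(arg_gt0 _ _ (ltW t0))//.
  rewrite [X in ln X](_ : _ = s * x k + y k); last by field; exact: lt0r_neq0.
  rewrite -lerBlDl -mulrBr (le_trans (ler_norm _))// normrM mulrCA ler_wpM2l//.
  exact: ln_perturb_le.
apply/ler_addgt0Pr => e e0.
(* The choice [s = e / (D + 1)] makes [s * D <= e], also when [D = 0]. *)
have D1 : 0 < D + 1 by rewrite ltr_wpDl.
apply: (le_trans (step (e / (D + 1)) _)); first by rewrite divr_gt0.
rewrite lerD2l -mulrA ger_pMr// mulrC ler_pdivrMr// mul1r; lra.
Qed.
End LogCombination.

(** * Conjugate transpose, and positivity under congruence *)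

Section Adjoint.
Local Set Implicit Arguments.
Local Unset Strict Implicit.
Variable R : realType.
Local Notation C := R[i].

Lemma adjE m n (A : 'M[C]_(m, n)) i j : adj A i j = (A j i)^*.
Proof. by rewrite !mxE. Qed.

Lemma adjK m n (A : 'M[C]_(m, n)) : adj (adj A) = A.
Proof. by apply/matrixP => i j; rewrite !adjE conjCK. Qed.

Lemma adjM m n p (A : 'M[C]_(m, n)) (B : 'M[C]_(n, p)) :
  adj (A *m B) = adj B *m adj A.
Proof. by rewrite /adj map_mxM trmx_mul. Qed.

Lemma adjN m n (A : 'M[C]_(m, n)) : adj (- A) = - adj A.
Proof. by apply/matrixP => i j; rewrite [RHS]mxE !adjE mxE rmorphN. Qed.

Lemma adjZ m n (a : C) (A : 'M[C]_(m, n)) : adj (a *: A) = a^* *: adj A.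
Proof. by apply/matrixP => i j; rewrite [RHS]mxE !adjE mxE rmorphM. Qed.

Lemma adj1 n : adj (1%:M : 'M[C]_n) = 1%:M.
Proof. by rewrite /adj map_mx1 trmx1. Qed.

Lemma adj_delta n (i j : 'I_n) :
  adj (delta_mx i j : 'M[C]_n) = delta_mx j i.
Proof. by rewrite /adj map_delta_mx trmx_delta. Qed.

Lemma mxtrace_adj n (A : 'M[C]_n) : \tr (adj A) = (\tr A)^*.
Proof.
by rewrite /adj mxtrace_tr rmorph_sum; apply: eq_bigr => i _; rewrite mxE.
Qed.

Lemma psd_congr m n (B : 'M[C]_(m, n)) (A : 'M[C]_n) :
  psd A -> psd (B *m A *m adj B).
Proof.
move=> [Ah A_ge0]; split; first by rewrite /Defs.hermitian !adjM adjK Ah mulmxA.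
by move=> v; have := A_ge0 (v *m B); rewrite adjM !mulmxA.
Qed.

Lemma psd_scale n (a : C) (A : 'M[C]_n) : 0 <= a -> psd A -> psd (a *: A).
Proof.
move=> a_ge0 [Ah A_ge0]; split.
  by rewrite /Defs.hermitian adjZ Ah conj_Creal// ger0_real.
by move=> v; rewrite -scalemxAr -scalemxAl mxE mulr_ge0.
Qed.

Lemma psd1 n : psd (1%:M : 'M[C]_n).
Proof.
split=> [|v]; first exact: adj1.
by rewrite mulmx1 mxE sumr_ge0// => i _; rewrite adjE mul_conjC_ge0.
Qed.

Lemma psd_diag_ge0 n (A : 'M[C]_n) i : psd A -> 0 <= A i i.
Proof.
move=> [_ /(_ (delta_mx 0 i))].
by rewrite -rowE /adj map_delta_mx trmx_delta -colE !mxE.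
Qed.

Lemma psd_trace_ge0 n (A : 'M[C]_n) : psd A -> 0 <= \tr A.
Proof. by move=> Ap; rewrite sumr_ge0// => i _; exact: psd_diag_ge0. Qed.

Lemma posdef_psd n (A : 'M[C]_n) : posdef A -> psd A.
Proof.
move=> [Ah A_gt0]; split=> // v.
have [->|/A_gt0/ltW//] := eqVneq v 0.
by rewrite !mul0mx mxE.
Qed.

Lemma posdef_diag_gt0 n (A : 'M[C]_n) i : posdef A -> 0 < A i i.
Proof.
move=> [_ /(_ (delta_mx 0 i))].
rewrite -rowE /adj map_delta_mx trmx_delta -colE !mxE; apply.
apply/eqP => /matrixP/(_ 0 i); rewrite !mxE !eqxx => /eqP.
by rewrite oner_eq0.
Qed.

Lemma posdef_congr m n (B : 'M[C]_(m, n)) (A : 'M[C]_n) :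
  row_free B -> posdef A -> posdef (B *m A *m adj B).
Proof.
move=> Bfree [Ah A_gt0]; split.
  by rewrite /Defs.hermitian !adjM adjK Ah mulmxA.
move=> v v0; have := A_gt0 (v *m B); rewrite adjM !mulmxA; apply.
apply: contra v0 => /eqP vB; apply/eqP/(row_free_inj Bfree).
by rewrite vB mul0mx.
Qed.

End Adjoint.

(** * Block matrices, the dual map and its Schwarz inequality *)

Section CompletelyPositive.
Local Set Implicit Arguments.
Local Unset Strict Implicit.
Variables (R : realType) (n : nat).
Local Notation C := R[i].

(** A block column: conjugating a positive [rho] by it gives a positive matrix with blocks
    [Z a *m rho *m adj (Z b)], a valid input for the ampliation. *)
Definition stackmx k (Z : 'I_k -> 'M[C]_n) : 'M[C]_(k * n, n) :=
  \matrix_(i, j) Z (mxtens_unindex i).1 (mxtens_unindex i).2 j.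

Lemma sum_mxtens_index k (f : 'I_(k * n) -> C) :
  \sum_i f i = \sum_a \sum_j f (mxtens_index (a, j)).
Proof.
rewrite pair_big/= (reindex (@mxtens_index k n))/=.
  by apply: eq_bigr => -[].
exists (@mxtens_unindex k n) => i _; [exact: mxtens_indexK|].
exact: mxtens_unindexK.
Qed.

Lemma mxblock_at_stackmx k (Z : 'I_k -> 'M[C]_n) rho a b :
  mxblock_at (stackmx Z *m rho *m adj (stackmx Z)) a b
  = Z a *m rho *m adj (Z b).
Proof.
apply/matrixP => i j; rewrite mxE !mxE; apply: eq_bigr => l _.
by rewrite !adjE !mxE !mxtens_indexK; congr (_ * _); apply: eq_bigr => h _;
  rewrite !mxE mxtens_indexK.
Qed.

(** Compression of [Q] by the block row of the [Y a], which is written as the adjoint of a block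
    column. *)
Lemma stackmx_congr k (Y : 'I_k -> 'M[C]_n) (Q : 'M[C]_(k * n)) :
  adj (stackmx (fun a => adj (Y a))) *m Q *m stackmx (fun a => adj (Y a))
  = \sum_a \sum_b Y a *m mxblock_at Q a b *m adj (Y b).
Proof.
rewrite exchange_big/=; apply/matrixP => i j.
rewrite summxE mxE sum_mxtens_index; apply: eq_bigr => b _.
rewrite -mulmx_suml [RHS]mxE; apply: eq_bigr => h _.
rewrite [in X in _ * X]mxE mxtens_indexK summxE; congr (_ * _).
rewrite mxE sum_mxtens_index; apply: eq_bigr => a _.
rewrite [RHS]mxE; apply: eq_bigr => l _.
by rewrite !mxE mxtens_indexK/= conjCK.
Qed.

Lemma mxblock_at_ampliation (E : 'M[C]_n -> 'M[C]_n) k (X : 'M[C]_(k * n)) a b :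
  mxblock_at (ampliation E X) a b = E (mxblock_at X a b).
Proof.
apply/matrixP => i j; rewrite mxE /ampliation summxE (bigD1 a)//= summxE.
rewrite (bigD1 b)//=.
rewrite tensmxE mxE !eqxx mul1r !big1 ?addr0// => [c ca|c cb].
  by rewrite summxE big1// => e _; rewrite tensmxE mxE eq_sym (negbTE ca) mul0r.
by rewrite tensmxE mxE [b == c]eq_sym (negbTE cb) andbF mul0r.
Qed.

Lemma mxblock_at_adj k (X : 'M[C]_(k * n)) a b :
  mxblock_at (adj X) a b = adj (mxblock_at X b a).
Proof. by apply/matrixP => i j; rewrite adjE !mxE. Qed.

Variable E : {linear 'M[C]_n -> 'M[C]_n}.
Hypothesis cpE : completely_positive E.

(** Conjugate [rho] by the column of the [Z a], apply complete positivity at level [k], then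
    compress by the row of the [Y a]; each operation preserves positivity. *)
Lemma cp_stack_psd k (Z Y : 'I_k -> 'M[C]_n) rho : psd rho ->
  psd (\sum_a \sum_b Y a *m E (Z a *m rho *m adj (Z b)) *m adj (Y b)).
Proof.
move=> /(psd_congr (stackmx Z))/cpE.
move=> /(psd_congr (adj (stackmx (fun a => adj (Y a))))).
rewrite adjK stackmx_congr.
by under eq_bigr do under eq_bigr do
  rewrite mxblock_at_ampliation mxblock_at_stackmx.
Qed.

Lemma cp_psd rho : psd rho -> psd (E rho).
Proof.
move=> /(@cp_stack_psd 1 (fun=> 1%:M) (fun=> 1%:M)).
by rewrite !big_ord1 adj1 !mulmx1 !mul1mx.
Qed.

(** The positive matrix built from the column [(A, 1)] has [A] and [adj A] as its off-diagonal
    blocks. Its image under the ampliation is Hermitian, which relates [E A] to [E (adj A)]. *)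
Lemma cp_adj A : E (adj A) = adj (E A).
Proof.
pose Z (a : 'I_2) : 'M[C]_n := if a == 0 then A else 1%:M.
have /cpE[Qh _] := psd_congr (stackmx Z) (psd1 R n).
have := mxblock_at_ampliation E (stackmx Z *m 1%:M *m adj (stackmx Z)) 1 0.
rewrite -Qh mxblock_at_adj mxblock_at_ampliation !mxblock_at_stackmx /Z/=.
by rewrite adj1 !mulmx1 mul1mx.
Qed.

(** The dual of [E] for the bilinear pairing [\tr (X *m A)]. The indices are swapped because pairing
    [X] with [delta_mx j i] extracts [X i j]. *)
Definition dualmx (Y : 'M[C]_n) : 'M[C]_n :=
  \matrix_(i, j) \tr (Y *m E (delta_mx j i)).

Lemma mxtrace_dualmx Y A : \tr (dualmx Y *m A) = \tr (Y *m E A).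
Proof.
have -> : Y *m E A = \sum_i \sum_j A i j *: (Y *m E (delta_mx i j)).
  rewrite {1}[A]matrix_sum_delta linear_sum/= mulmx_sumr; apply: eq_bigr => i _.
  rewrite linear_sum/= mulmx_sumr; apply: eq_bigr => j _.
  by rewrite linearZ/= scalemxAr.
transitivity (\sum_j \sum_i dualmx Y j i * A i j).
  by apply: eq_bigr => j _; rewrite mxE.
rewrite exchange_big/= raddf_sum/=; apply: eq_bigr => i _; rewrite raddf_sum/=.
by apply: eq_bigr => j _; rewrite mxtraceZ mxE mulrC.
Qed.

Lemma dualmx_adj Y : dualmx (adj Y) = adj (dualmx Y).
Proof.
apply/matrixP => i j; rewrite adjE !mxE -mxtrace_adj adjM -cp_adj adj_delta.
by rewrite mxtrace_mulC.
Qed.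

(* Kadison-Schwarz inequality for the dual map: the positive image of the block
   column (1, X) is tested against the block row (Y, -1). *)
Lemma cp_schwarz rho Y : trace_preserving E -> psd rho ->
  \tr (dualmx Y *m rho *m adj (dualmx Y)) <= \tr (Y *m E rho *m adj Y).
Proof.
move=> tpE rho_psd; set X := dualmx Y.
pose Z (a : 'I_2) := if a == 0 then 1%:M else X.
pose W (a : 'I_2) := if a == 0 then Y else - 1%:M.
have /psd_trace_ge0 := cp_stack_psd Z W rho_psd.
have sum2 (F : 'I_2 -> 'M[C]_n) : \sum_a F a = F 0 + F 1.
  by rewrite big_ord_recl big_ord1; congr (_ + F _); exact: val_inj.
rewrite sum2 !{}sum2 /Z /W/= !mul1mx.
rewrite adjN adj1 !mulmxN !mulNmx !mul1mx !mulmx1 opprK !mxtraceD !raddfN/=.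
have -> : \tr (E (X *m rho *m adj X)) = \tr (X *m rho *m adj X) by exact: tpE.
(* By duality both cross terms equal [\tr (X *m rho *m adj X)]; they enter with a minus sign, and
   one of them cancels the last diagonal term. *)
have t1 : \tr (Y *m E (rho *m adj X)) = \tr (X *m rho *m adj X).
  by rewrite -mxtrace_dualmx mulmxA.
have t2 : \tr (E (X *m rho) *m adj Y) = \tr (X *m rho *m adj X).
  rewrite mxtrace_mulC -mxtrace_dualmx dualmx_adj -/X.
  by rewrite mxtrace_mulC.
by rewrite t1 t2 addNr addr0 subr_ge0.
Qed.

End CompletelyPositive.

(** * Traces in eigenbases, and the variational formula for [q_t] *)

Section Spectrum.
Variables (R : realType) (n : nat).
Local Notation C := R[i].
Local Set Implicit Arguments.
Local Unset Strict Implicit.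
Implicit Types (A rho sigma X : 'M[C]_n).

Definition eigval A (i : 'I_n) : R := complex.Re (spectral_diag A 0 i).

Definition realdiag (l : 'I_n -> R) : 'M[C]_n := diag_mx (\row_i (l i)%:C%C).

Lemma mul_realdiag_mx l A i j : (realdiag l *m A) i j = (l i)%:C%C * A i j.
Proof. by rewrite mul_diag_mx !mxE. Qed.

Lemma mul_mx_realdiag l A i j : (A *m realdiag l) i j = A i j * (l j)%:C%C.
Proof. by rewrite mul_mx_diag !mxE. Qed.

Lemma adjE_sesqui m (A : 'M[C]_(m, n)) : adj A = (A ^t*)%sesqui.
Proof. by rewrite /adj map_trmx. Qed.

Lemma spectralmxK A : spectralmx A *m adj (spectralmx A) = 1%:M.
Proof. by rewrite adjE_sesqui; apply/unitarymxP/spectral_unitarymx. Qed.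

Lemma spectralmxVK A : adj (spectralmx A) *m spectralmx A = 1%:M.
Proof. exact: mulmx1C (spectralmxK A). Qed.

Lemma conjC_realC (x : R) : (x%:C%C : C)^* = x%:C%C.
Proof. exact: conjc_real. Qed.

Lemma invmx_spectralmx A : invmx (spectralmx A) = adj (spectralmx A).
Proof. by rewrite adjE_sesqui invmx_unitary// spectral_unitarymx. Qed.

Lemma mxfunE f A :
  mxfun f A = adj (spectralmx A) *m realdiag (f \o eigval A) *m spectralmx A.
Proof.
rewrite /mxfun invmx_spectralmx /realdiag.
suff -> : map_mx (fun z : C => (f (complex.Re z))%:C%C) (spectral_diag A)
          = \row_i ((f \o eigval A) i)%:C%C by [].
by apply/rowP => i; rewrite !mxE.
Qed.

Lemma hermitian_spectralE A : Defs.hermitian A ->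
  A = adj (spectralmx A) *m realdiag (eigval A) *m spectralmx A.
Proof.
move=> Ah.
have Aherm : A \is hermsymmx.
  by apply/is_hermitianmxP; rewrite expr0 scale1r -adjE_sesqui Ah.
have /orthomx_spectralP {1}-> := hermitian_normalmx Aherm.
rewrite invmx_spectralmx /realdiag.
suff -> : spectral_diag A = \row_i (eigval A i)%:C%C by [].
apply/rowP => i; rewrite mxE /eigval.
rewrite RRe_real//; exact: (mxOverP (hermitian_spectral_diag_real Aherm)).
Qed.

Lemma spectral_congr A : Defs.hermitian A ->
  spectralmx A *m A *m adj (spectralmx A) = realdiag (eigval A).
Proof.
move=> /hermitian_spectralE {2}->.
by rewrite !mulmxA spectralmxK mul1mx -mulmxA spectralmxK mulmx1.
Qed.

Lemma realdiag_diag l i : realdiag l i i = (l i)%:C%C.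
Proof. by rewrite !mxE eqxx mulr1n. Qed.

Lemma eigval_ge0 A i : psd A -> 0 <= eigval A i.
Proof.
move=> Ap; have := psd_diag_ge0 i (psd_congr (spectralmx A) Ap).
by rewrite spectral_congr ?realdiag_diag ?ler0c//; case: Ap.
Qed.

Lemma eigval_gt0 A i : posdef A -> 0 < eigval A i.
Proof.
move=> Ap.
have Ufree : row_free (spectralmx A) by rewrite row_free_unit spectral_unit.
have := posdef_diag_gt0 i (posdef_congr Ufree Ap).
by rewrite spectral_congr ?realdiag_diag ?ltcR//; case: Ap.
Qed.

(** The unitary change of basis between the two eigenbases; its squared moduli are the weights
    [w_ij]. *)
Definition transmx rho sigma : 'M[C]_n :=
  spectralmx rho *m adj (spectralmx sigma).

Definition overlap rho sigma i j : R :=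
  complex.Re (`|transmx rho sigma i j| ^+ 2).

Lemma overlapE rho sigma i j : (overlap rho sigma i j)%:C%C
  = transmx rho sigma i j * (transmx rho sigma i j)^*.
Proof. by rewrite -normCK RRe_real// rpredX// normr_real. Qed.

Lemma overlap_row rho sigma i : \sum_j overlap rho sigma i j = 1.
Proof.
apply: (@complexI R); rewrite rmorph_sum/= rmorph1.
have : (transmx rho sigma *m adj (transmx rho sigma)) i i = 1.
  rewrite /transmx adjM adjK mulmxA -[_ *m adj _ *m _]mulmxA spectralmxVK.
  by rewrite mulmx1 spectralmxK mxE eqxx.
by rewrite mxE => <-; apply: eq_bigr => j _; rewrite overlapE adjE.
Qed.

Lemma mxtrace_spectral rho sigma l k :
  \tr (adj (spectralmx rho) *m realdiag l *m spectralmx rho *m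
       (adj (spectralmx sigma) *m realdiag k *m spectralmx sigma))
  = (\sum_i \sum_j l i * overlap rho sigma i j * k j)%:C%C.
Proof.
set V := spectralmx rho; set U := spectralmx sigma.
transitivity (\tr (realdiag l *m (transmx rho sigma) *m realdiag k *m
                   adj (transmx rho sigma))).
  rewrite -!mulmxA mxtrace_mulC /transmx -/U -/V adjM adjK !mulmxA.
  by rewrite -!mulmxA.
rewrite rmorph_sum/=; apply: eq_bigr => i _.
rewrite mxE rmorph_sum/=; apply: eq_bigr => j _.
rewrite mul_mx_realdiag mul_realdiag_mx adjE 2!rmorphM/= overlapE; ring.
Qed.

Lemma trlogE rho sigma : Defs.hermitian rho ->
  trlog rho sigma
  = \sum_i \sum_j eigval rho i * overlap rho sigma i j * ln (eigval sigma j).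
Proof.
move=> rho_h; rewrite /trlog /logm mxfunE {1}(hermitian_spectralE rho_h).
by rewrite mxtrace_spectral.
Qed.

(** Each row of overlaps sums to one, so [sigma] can be inserted freely. This gives [tr[rho ln rho]]
    the same weights as [tr[rho ln sigma]]. On the other side, the overlaps of [rho] with itself
    form the identity matrix. *)
Lemma trlog_selfE rho sigma : Defs.hermitian rho ->
  trlog rho rho
  = \sum_i \sum_j eigval rho i * overlap rho sigma i j * ln (eigval rho i).
Proof.
move=> rho_h; rewrite trlogE//.
apply: eq_bigr => i _.
under [RHS]eq_bigr do rewrite mulrAC.
rewrite -mulr_sumr overlap_row mulr1 (bigD1 i)//= big1 ?addr0 => [|j ji].
  by rewrite /overlap /transmx spectralmxK mxE eqxx normr1 expr1n mulr1.
rewrite /overlap /transmx spectralmxK mxE eq_sym (negbTE ji) normr0 expr0n/=.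
by rewrite mulr0 mul0r.
Qed.

Lemma mxtraceE rho sigma : Defs.hermitian rho ->
  \tr rho = (\sum_i \sum_j eigval rho i * overlap rho sigma i j)%:C%C.
Proof.
move=> rho_h; rewrite {1}(hermitian_spectralE rho_h) mxtrace_mulC mulmxA.
rewrite spectralmxK mul1mx rmorph_sum; apply: eq_bigr => i _.
by rewrite realdiag_diag -mulr_sumr overlap_row mulr1.
Qed.

(** Twice the real part is written as a number plus its conjugate, so that all comparisons stay in
    the order of [C]. *)
Definition quad rho sigma (t : R) X : C :=
  \tr (X *m rho) + (\tr (X *m rho))^* - \tr (adj X *m sigma *m X)
  - t%:C%C * \tr (X *m rho *m adj X).

(** This is [q_t(rho, sigma)]. *)
Definition resolvent_form rho sigma (t : R) : R :=
  \sum_i \sum_j eigval rho i * overlap rho sigma i j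
                * (eigval rho i / (eigval sigma j + t * eigval rho i)).

(** In eigenbasis coordinates the functional decouples: each entry of [Z] occurs in a single
    summand, so the maximum can be taken entry by entry. *)
Lemma quad_spectral rho sigma t (Z : 'M[C]_n) :
  Defs.hermitian rho -> Defs.hermitian sigma ->
  quad rho sigma t (adj (spectralmx sigma) *m Z *m spectralmx rho) =
  \sum_i \sum_j
    ((eigval rho i)%:C%C * (Z j i * transmx rho sigma i j
                           + (Z j i * transmx rho sigma i j)^*)
     - (eigval sigma j + t * eigval rho i)%:C%C * (Z j i * (Z j i)^*)).
Proof.
move=> rho_h sigma_h.
have rho_s := hermitian_spectralE rho_h.
have sigma_s := hermitian_spectralE sigma_h.
set l := eigval rho in rho_s *; set k := eigval sigma in sigma_s *.
rewrite /transmx.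
set V := spectralmx rho in rho_s *; set U := spectralmx sigma in sigma_s *.
set X := _ *m Z *m _; set W := V *m adj U.
have VK : V *m adj V = 1%:M by exact: spectralmxK.
have UK : U *m adj U = 1%:M by exact: spectralmxK.
have t1 : \tr (X *m rho) = \sum_i \sum_j (l i)%:C%C * (Z j i * W i j).
  have -> : X *m rho = adj U *m (Z *m realdiag l *m V).
    by rewrite rho_s /X !mulmxA -[_ *m V *m adj V]mulmxA VK mulmx1.
  rewrite mxtrace_mulC -[_ *m V *m _]mulmxA mxtrace_mulC.
  apply: eq_bigr => i _; rewrite mxE.
  by apply: eq_bigr => j _; rewrite mul_mx_realdiag; ring.
have t2 : \tr (adj X *m sigma *m X) =
    \sum_i \sum_j (k j)%:C%C * (Z j i * (Z j i)^*).
  have -> : adj X *m sigma *m X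
            = adj V *m (adj Z *m (realdiag k *m Z) *m V).
    rewrite sigma_s /X !adjM adjK !mulmxA -[_ *m U *m adj U]mulmxA UK mulmx1.
    by rewrite -[_ *m U *m adj U]mulmxA UK mulmx1.
  rewrite mxtrace_mulC -[_ *m V *m _]mulmxA VK mulmx1.
  apply: eq_bigr => i _; rewrite mxE.
  by apply: eq_bigr => j _; rewrite mul_realdiag_mx adjE; ring.
have t3 : \tr (X *m rho *m adj X) =
    \sum_i \sum_j (l i)%:C%C * (Z j i * (Z j i)^*).
  have -> : X *m rho *m adj X
            = adj U *m (Z *m realdiag l *m adj Z *m U).
    rewrite rho_s /X !adjM adjK !mulmxA -[_ *m V *m adj V]mulmxA VK mulmx1.
    by rewrite -[_ *m V *m adj V]mulmxA VK mulmx1.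
  rewrite mxtrace_mulC -[_ *m U *m _]mulmxA UK mulmx1 mxtrace_mulC.
  apply: eq_bigr => i _; rewrite mxE.
  by apply: eq_bigr => j _; rewrite mul_mx_realdiag adjE; ring.
rewrite /quad t1 t2 t3 rmorph_sum mulr_sumr -big_split/= -!sumrB.
apply: eq_bigr => i _; rewrite rmorph_sum mulr_sumr -big_split/= -!sumrB.
apply: eq_bigr => j _; rewrite !rmorphM/= !conjC_realC rmorphD/= rmorphM/=.
ring.
Qed.

(** The gap between the maximum and the value for one entry [z]; it vanishes exactly at
    [z = (l / a) u^*]. *)
Lemma complete_square (l a w : R) (z u : C) : 0 < a -> w%:C%C = u * u^* ->
  (l * w * (l / a))%:C%C
    - (l%:C%C * (z * u + (z * u)^*) - a%:C%C * (z * z^*))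
  = a%:C%C * `|z - (l / a)%:C%C * u^*| ^+ 2.
Proof.
move=> a0 wE; have aC : a%:C%C != 0 by rewrite gt_eqF// ltcR.
rewrite normCK !rmorphB/= !rmorphM/= !conjCK wE.
have -> : a^-1%:C%C = (a%:C%C)^-1 by rewrite fmorphV.
rewrite fmorphV/= !conjC_realC.
by field.
Qed.

Lemma quad_le rho sigma t X : psd rho -> posdef sigma -> 0 < t ->
  quad rho sigma t X <= (resolvent_form rho sigma t)%:C%C.
Proof.
move=> rho_p sigma_p t0.
have [[rho_h _] [sigma_h _]] := (rho_p, sigma_p).
(* Every [X] has the form required by [quad_spectral], as the spectral matrices are unitary. *)
have -> : X = adj (spectralmx sigma) *m
    (spectralmx sigma *m X *m adj (spectralmx rho)) *m spectralmx rho.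
  by rewrite !mulmxA spectralmxVK mul1mx -mulmxA spectralmxVK mulmx1.
rewrite quad_spectral// rmorph_sum; apply: ler_sum => i _.
rewrite rmorph_sum; apply: ler_sum => j _.
have a0 : 0 < eigval sigma j + t * eigval rho i.
  by rewrite ltr_pwDl ?eigval_gt0// mulr_ge0 ?eigval_ge0// ltW.
rewrite -subr_ge0 complete_square ?overlapE//.
by rewrite mulr_ge0 ?exprn_ge0// ler0c ltW.
Qed.

Lemma quad_attained rho sigma t : psd rho -> posdef sigma -> 0 < t ->
  exists X, quad rho sigma t X = (resolvent_form rho sigma t)%:C%C.
Proof.
move=> rho_p sigma_p t0.
have [[rho_h _] [sigma_h _]] := (rho_p, sigma_p).
(* Each entry is the point at which the square in [complete_square] vanishes. *)
pose Z : 'M[C]_n := \matrix_(j, i)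
  ((eigval rho i / (eigval sigma j + t * eigval rho i))%:C%C
   * (transmx rho sigma i j)^*).
exists (adj (spectralmx sigma) *m Z *m spectralmx rho).
rewrite quad_spectral// rmorph_sum; apply: eq_bigr => i _.
rewrite rmorph_sum; apply: eq_bigr => j _.
have a0 : 0 < eigval sigma j + t * eigval rho i.
  by rewrite ltr_pwDl ?eigval_gt0// mulr_ge0 ?eigval_ge0// ltW.
apply/esym/eqP; rewrite -subr_eq0 complete_square ?overlapE//.
by rewrite [Z j i]mxE subrr normr0 expr0n mulr0.
Qed.


End Spectrum.

(** * Monotonicity of relative entropy, and the entropy bound for one step *)

Section DataProcessing.
Variables (R : realType) (n : nat).
Local Notation C := R[i].
Local Set Implicit Arguments.
Local Unset Strict Implicit.
Variable E : {linear 'M[C]_n -> 'M[C]_n}.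
Hypotheses (cpE : completely_positive E) (tpE : trace_preserving E).

Lemma resolvent_form_monotone rho sigma t :
  psd rho -> posdef sigma -> posdef (E sigma) -> 0 < t ->
  resolvent_form (E rho) (E sigma) t <= resolvent_form rho sigma t.
Proof.
move=> rho_p sigma_p Esigma_p t0.
have [Y YE] := quad_attained (cp_psd cpE rho_p) Esigma_p t0.
rewrite -lecR -YE; apply: le_trans (quad_le (dualmx E Y) rho_p sigma_p t0).
rewrite /quad mxtrace_dualmx.
(* The linear terms agree by duality. The Schwarz inequality is used twice: for [Y] in the [rho]
   term, and for [adj Y] in the [sigma] term, where the adjoint stands on the left. *)
have s1 := cp_schwarz cpE Y tpE rho_p.
have := cp_schwarz cpE (adj Y) tpE (posdef_psd sigma_p).
rewrite (dualmx_adj cpE) !adjK => s2.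
by rewrite !lerB// ler_wpM2l// ler0c ltW.
Qed.

Lemma data_processing rho sigma :
  psd rho -> posdef sigma -> posdef (E sigma) ->
  trlog (E rho) (E rho) - trlog (E rho) (E sigma)
  <= trlog rho rho - trlog rho sigma.
Proof.
move=> rho_p sigma_p Esigma_p.
have Erho_p := cp_psd cpE rho_p.
have [[rho_h _] [Erho_h _]] := (rho_p, Erho_p).
pose I2 := ('I_n * 'I_n)%type.
(* Two copies of the index pairs, the first for [(rho, sigma)] and the second, with negated weights,
   for the image pair, make the difference a single logarithmic combination. *)
pose glue (f g : I2 -> R) (k : I2 + I2) :=
  match k with inl p => f p | inr p => g p end.
pose wt (r s : 'M[C]_n) (p : I2) := eigval r p.1 * overlap r s p.1 p.2.
pose c := glue (wt rho sigma) (fun p => - wt (E rho) (E sigma) p).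
pose x := glue (fun p => eigval sigma p.2) (fun p => eigval (E sigma) p.2).
pose y := glue (fun p => eigval rho p.1) (fun p => eigval (E rho) p.1).
(* Used with [phi] constant for the total weight, with [b / (a + s * b)] for the derivative, and
   with [ln a] and [ln b] for the two ends of the ray. *)
have sumE (phi : R -> R -> R) : \sum_k c k * phi (x k) (y k)
    = \sum_i \sum_j eigval rho i * overlap rho sigma i j
                    * phi (eigval sigma j) (eigval rho i)
    - \sum_i \sum_j eigval (E rho) i * overlap (E rho) (E sigma) i j
                    * phi (eigval (E sigma) j) (eigval (E rho) i).
  rewrite big_sumType/= !pair_big/= -sumrN; congr (_ + _).
  by apply: eq_bigr => p _; rewrite mulNr.
have x_gt0 k : 0 < x k by case: k => p; apply: eigval_gt0.
have y_ge0 k : 0 <= y k by case: k => p; apply: eigval_ge0.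
have c_sum : \sum_k c k = 0.
  have := sumE (fun _ _ => 1).
  rewrite (eq_bigr c); last by move=> k _; rewrite mulr1.
  move=> ->; apply/eqP; rewrite subr_eq0; apply/eqP/(@complexI R).
  have marg (r s : 'M[C]_n) : psd r ->
      (\sum_i \sum_j eigval r i * overlap r s i j * 1)%:C%C = \tr r.
    move=> [r_h _]; rewrite (mxtraceE s r_h); congr (_%:C%C).
    by apply: eq_bigr => i _; apply: eq_bigr => j _; rewrite mulr1.
  by rewrite (marg _ sigma rho_p) (marg _ (E sigma) Erho_p) tpE.
have c_supp k : y k = 0 -> c k = 0.
  by case: k => p; rewrite /c/= /wt => ->; rewrite mul0r ?oppr0.
have form_ge0 (s : R) : 0 < s -> 0 <= \sum_k c k * (y k / (x k + s * y k)).
  move=> s0; rewrite (sumE (fun a b => b / (a + s * b))) subr_ge0.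
  exact: resolvent_form_monotone.
have := log_combination_le R _ c x y x_gt0 y_ge0 c_sum c_supp form_ge0.
rewrite (sumE (fun a _ => ln a)) (sumE (fun _ b => ln b)).
rewrite -(trlogE sigma rho_h) -(trlogE (E sigma) Erho_h).
rewrite -(trlog_selfE sigma rho_h) -(trlog_selfE (E sigma) Erho_h).
have swap (u v w z : R) : u - v <= w - z -> z - v <= w - u.
  by clear; lra.
exact: swap.
Qed.

(** At a fixed point both relative entropies in [data_processing] refer to the same [sigma], and the
    inequality only has to be rearranged. *)
Lemma entropy_step rho sigma : psd rho -> E sigma = sigma -> posdef sigma ->
  - (trlog (E rho) sigma - trlog rho sigma)
  <= vN_entropy (E rho) - vN_entropy rho.
Proof.
move=> rho_p Esigma sigma_p.
have := data_processing rho_p sigma_p; rewrite Esigma => /(_ sigma_p).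
have flip (u v w z : R) : u - v <= w - z -> - (v - z) <= - u - - w.
  by clear; lra.
exact: flip.
Qed.

End DataProcessing.

(** Induction on the number of steps, carrying positivity of the current state along for
    [entropy_step]. The free starting time [s] lets it serve before and after the measurement. *)
Lemma entropy_evolve (R : realType) (n : nat)
    (E : nat -> {linear 'M[R[i]]_n -> 'M[R[i]]_n}) (sigma : nat -> 'M[R[i]]_n)
    (s : nat) (rho : 'M[R[i]]_n) (m : nat) :
  psd rho ->
  (forall k, (s < k <= s + m)%N ->
     CPTP (E k) /\ unique_steady_state (E k) (sigma k) /\ posdef (sigma k)) ->
  psd (evolve E s rho m) /\
  - (\sum_(s.+1 <= k < (s + m).+1)
       (trlog (evolve E s rho (k - s)) (sigma k)
        - trlog (evolve E s rho (k.-1 - s)) (sigma k)))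
  <= vN_entropy (evolve E s rho m) - vN_entropy rho.
Proof.
move=> rho_p EP; elim: m EP => [|m IH] EP.
  by rewrite addn0 big_geq// oppr0 subrr.
have [k /andP[sk km]|em_p em_le] := IH.
  by apply: EP; rewrite sk (leq_trans km)// leq_add2l.
have [|[cpE tpE] [[_ [Esigma _]] sigma_p]] := EP (s + m.+1)%N.
  by rewrite leqnn addnS ltnS leq_addr.
split; first exact: cp_psd.
rewrite addnS big_nat_recr/=; last by rewrite ltnS leq_addr.
have := entropy_step cpE tpE em_p Esigma sigma_p.
(* For the last index [k = s + m.+1], the offsets [k - s] and [k.-1 - s] become [m.+1] and [m]. *)
rewrite -addnS !addKn/= !addnS => step.
have chain (u v x y z : R) : - u <= y - x -> - v <= z - y -> - (u + v) <= z - x.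
  by clear; lra.
exact: chain em_le step.
Qed.

Theorem theorem6p2
  (R : realType) (d : nat)                      (* H = C^d *)
  (rho_i : 'M[R[i]]_d)
  (m N : nat)
  (E : nat -> {linear 'M[R[i]]_d -> 'M[R[i]]_d})   (* E n, 1 <= n <= m *)
  (rho_ss : nat -> 'M[R[i]]_d)
  (B : finType) (M : B -> 'M[R[i]]_d)
  (Eb : B -> nat -> {linear 'M[R[i]]_d -> 'M[R[i]]_d}) (* Eb b n, m < n <= N *)
  (rho_ssb : B -> nat -> 'M[R[i]]_d) :
  density rho_i ->
  (1 <= m)%N -> (m < N)%N ->
  (forall n, (1 <= n <= m)%N ->
     CPTP (E n) /\ unique_steady_state (E n) (rho_ss n) /\ posdef (rho_ss n)) ->
  \sum_(b : B) adj (M b) *m M b = 1%:M ->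
  let rho := evolve E 0 rho_i in                 (* rho n = rho_n, 0 <= n <= m *)
  let p := fun b : B => complex.Re (\tr (adj (M b) *m M b *m rho m)) in
  let rho_post := fun b : B =>
    ((p b)%:C%C)^-1 *: (M b *m rho m *m adj (M b)) in (* rho_m^(b) *)
  (forall b : B, 0 < p b -> forall n, (m < n <= N)%N ->
     CPTP (Eb b n) /\ unique_steady_state (Eb b n) (rho_ssb b n)
     /\ posdef (rho_ssb b n)) ->
  (* rhob b n = rho_n^(b), m <= n <= N *)
  let rhob := fun (b : B) (n : nat) => evolve (Eb b) m (rho_post b) (n - m) in
  let I_QC := vN_entropy (rho m)
                - \sum_(b : B | 0 < p b) p b * vN_entropy (rho_post b) in
  let sigma_ex :=
    \sum_(1 <= n < m.+1) (trlog (rho n) (rho_ss n) - trlog (rho n.-1) (rho_ss n))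
    + \sum_(b : B | 0 < p b) p b *
        \sum_(m.+1 <= n < N.+1)
          (trlog (rhob b n) (rho_ssb b n) - trlog (rhob b n.-1) (rho_ssb b n)) in
  \sum_(b : B | 0 < p b) p b * vN_entropy (rhob b N) - vN_entropy rho_i
    >= - sigma_ex - I_QC.
Proof.
move=> rho_i_dens m1 mN EP Msum rho p rho_post EbP.
pose rhob (b : B) n := evolve (Eb b) m (rho_post b) (n - m).
pose sigma1 := \sum_(1 <= n < m.+1)
  (trlog (rho n) (rho_ss n) - trlog (rho n.-1) (rho_ss n)).
pose sigmab (b : B) := \sum_(m.+1 <= n < N.+1)
  (trlog (rhob b n) (rho_ssb b n) - trlog (rhob b n.-1) (rho_ssb b n)).
have [rho_m_p first_stage] : psd (rho m) /\
    - sigma1 <= vN_entropy (rho m) - vN_entropy rho_i.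
  have := entropy_evolve R d E rho_ss 0 rho_i m rho_i_dens.1 EP.
  by rewrite add0n; under eq_bigr do rewrite !subn0.
have second_stage (b : B) : 0 < p b ->
    - sigmab b <= vN_entropy (rhob b N) - vN_entropy (rho_post b).
  move=> pb.
  have post_p : psd (rho_post b).
    by apply: psd_scale; [rewrite invr_ge0 ler0c ltW | exact: psd_congr].
  have mNE : (m + (N - m))%N = N by rewrite subnKC// ltnW.
  have := entropy_evolve R d (Eb b) (rho_ssb b) m (rho_post b) (N - m) post_p.
  by rewrite mNE => /(_ (EbP b pb)) [].
(* The branch inequalities are averaged with the positive weights [p b]. *)
have second_stage_mean : - (\sum_(b : B | 0 < p b) p b * sigmab b)
    <= \sum_(b : B | 0 < p b) p b * vN_entropy (rhob b N)
       - \sum_(b : B | 0 < p b) p b * vN_entropy (rho_post b).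
  rewrite -sumrB -sumrN; apply: ler_sum => b pb.
  have scaled (q u v w : R) : 0 < q -> - u <= v - w -> - (q * u) <= q * v - q * w.
    by clear=> q0; rewrite -mulrN -mulrBr ler_pM2l.
  exact: scaled pb (second_stage b pb).
(* The averaged entropy change in the measurement is exactly minus [I_QC], so adding the two stages
   links [rho_i] to the final states. *)
suff : - (sigma1 + \sum_(b : B | 0 < p b) p b * sigmab b)
       - (vN_entropy (rho m)
          - \sum_(b : B | 0 < p b) p b * vN_entropy (rho_post b))
    <= \sum_(b : B | 0 < p b) p b * vN_entropy (rhob b N) - vN_entropy rho_i.
  by [].
have total (u v x y z w : R) :
    - u <= y - x -> - v <= w - z -> - (u + v) - (y - z) <= w - x.
  by clear; lra.
exact: total first_stage second_stage_mean.
Qed.
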